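(* Let $Q,Q'$ be two non-zero irreducible monomial ideals of $S=K[x_1,\ldots,x_n]$. Then $\operatorname{sdepth}(Q\cap Q')\geq \operatorname{depth}(Q\cap Q')$, that is, Stanley's Conjecture holds for $Q\cap Q'$.
   Context: $K$ is a field and $S=K[x_1,\ldots,x_n]$ with its standard $\mathbb{Z}^n$-grading (multigrading). A monomial ideal is irreducible if it is generated by powers of some of the variables. For a finitely generated multigraded $S$-module $M$, a homogeneous element $z\in M$ and $Z\subseteq\{x_1,\ldots,x_n\}$, let $zK[Z]\subset M$ be the $K$-subspace of all elements $zf$, $f\in K[Z]$; it is called a Stanley space of dimension $|Z|$ if it is a free $K[Z]$-module. A Stanley decomposition of $M$ is a presentation of the $K$-vector space $M$ as a finite direct sum of Stanley spaces $\mathcal{D}: M=\bigoplus_{i=1}^r z_iK[Z_i]$. Set $\operatorname{sdepth}\mathcal{D}=\min\{|Z_i|: i=1,\ldots,r\}$, and $\operatorname{sdepth}_S(M)=\operatorname{sdepth}(M)=\max\{\operatorname{sdepth}\mathcal{D}:\mathcal{D}\text{ a Stanley decomposition of }M\}$ (the Stanley depth of $M$). Stanley's Conjecture holds for $M$ if $\operatorname{sdepth}M\geq\operatorname{depth}M$, where depth is with respect to the maximal ideal $(x_1,\ldots,x_n)$. *)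

(* Defs.v *)
From HB Require Import structures.
From mathcomp Require Import all_boot all_order all_algebra.
From mathcomp Require Import mpoly.

Set Implicit Arguments.
Unset Strict Implicit.
Unset Printing Implicit Defensive.

Import GRing.Theory.
Local Open Scope ring_scope.

Definition is_max_nat (P : nat -> Prop) (m : nat) : Prop :=
  P m /\ forall k, P k -> (k <= m)%N.

Section Ideals.
Variables (K : fieldType) (n : nat).
Local Notation S := {mpoly K[n]}.

(* Ideals are represented by their membership predicates. *)

Definition ideal_gen (G : S -> Prop) (f : S) : Prop :=
  exists (r : nat) (c g : 'I_r -> S),
    (forall i, G (g i)) /\ f = \sum_(i < r) c i * g i.

Definition ideal_cap (I J : S -> Prop) (f : S) : Prop := I f /\ J f.

Definition ideal_nonzero (I : S -> Prop) : Prop := exists2 f, I f & f != 0.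

(* Exponents are positive, so that the unit ideal is not irreducible; [A] may
   be empty, which gives the zero ideal. *)
Definition irreducible_monomial_ideal (Q : S -> Prop) : Prop :=
  exists (A : {set 'I_n}) (a : 'I_n -> nat),
    (forall i, i \in A -> (0 < a i)%N) /\
    (forall f, Q f <-> ideal_gen (fun g => exists2 i, i \in A & g = 'X_i ^+ a i) f).

Definition graded_maximal_ideal : S -> Prop :=
  ideal_gen (fun g => exists i : 'I_n, g = 'X_i).

(* The submodule (f_1, ..., f_k) I of an ideal I, for [fs = f_1, ..., f_k];
   since I is an ideal, the ring coefficients are absorbed in the [h j]. *)
Definition seq_mul_ideal (fs : seq S) (I : S -> Prop) (g : S) : Prop :=
  exists h : 'I_(size fs) -> S,
    (forall j, I (h j)) /\ g = \sum_(j < size fs) fs`_j * h j.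

(* [fs] is a regular sequence on the S-module I: each f_(k+1) is a
   nonzerodivisor on I / (f_1, ..., f_k) I, and I <> (f_1, ..., f_r) I. *)
Definition regular_seq (I : S -> Prop) (fs : seq S) : Prop :=
  (forall k, (k < size fs)%N -> forall g, I g ->
     seq_mul_ideal (take k fs) I (fs`_k * g) -> seq_mul_ideal (take k fs) I g) /\
  (exists2 g, I g & ~ seq_mul_ideal fs I g).

Definition is_depth (I : S -> Prop) : nat -> Prop :=
  is_max_nat (fun k => exists fs : seq S,
    [/\ size fs = k, (forall f, f \in fs -> graded_maximal_ideal f)
      & regular_seq I fs]).

(* Homogeneous for the standard Z^n-grading, whose component of degree m is
   K x^m for m in N^n and 0 otherwise. *)
Definition multihomogeneous (z : S) : Prop :=
  exists (c : K) (m : 'X_{1..n}), z = c *: 'X_[m].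

(* Membership in the subalgebra K[Z] of S. *)
Definition in_subpoly (Z : {set 'I_n}) (f : S) : Prop :=
  forall m, m \in msupp f -> forall i, i \notin Z -> m i = 0%N.

Definition in_zKZ (z : S) (Z : {set 'I_n}) (g : S) : Prop :=
  exists2 f, in_subpoly Z f & g = z * f.

(* z K[Z] is a Stanley space of I; freeness over K[Z] means that z is a basis.
   In particular z <> 0. *)
Definition stanley_space (I : S -> Prop) (z : S) (Z : {set 'I_n}) : Prop :=
  [/\ I z, multihomogeneous z
    & forall f, in_subpoly Z f -> z * f = 0 -> f = 0].

(* I is the internal direct sum, as a K-vector space, of the z_i K[Z_i]. *)
Definition stanley_decomposition (I : S -> Prop) (r : nat)
    (z : 'I_r -> S) (Z : 'I_r -> {set 'I_n}) : Prop :=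
  [/\ forall i, stanley_space I (z i) (Z i),
      forall g, I g <-> exists w : 'I_r -> S,
        (forall i, in_zKZ (z i) (Z i) (w i)) /\ g = \sum_(i < r) w i
    & forall w : 'I_r -> S, (forall i, in_zKZ (z i) (Z i) (w i)) ->
        \sum_(i < r) w i = 0 -> forall i, w i = 0].

(* The default value n is neutral, as #|Z i| <= n, so this is the minimum
   whenever r > 0; r = 0 occurs only for the zero ideal. *)
Definition sdepth_decomposition (r : nat) (Z : 'I_r -> {set 'I_n}) : nat :=
  \big[minn/n]_(i < r) #|Z i|.

Definition is_sdepth (I : S -> Prop) : nat -> Prop :=
  is_max_nat (fun k => exists (r : nat) (z : 'I_r -> S) (Z : 'I_r -> {set 'I_n}),
    stanley_decomposition I z Z /\ sdepth_decomposition Z = k).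

End Ideals.

(* Main.v *)
Require Import Defs.
From HB Require Import structures.
From mathcomp Require Import all_boot all_order all_algebra.
From mathcomp Require Import mpoly.
From Stdlib Require Import Classical_Prop.

Set Implicit Arguments.
Unset Strict Implicit.
Unset Printing Implicit Defensive.

Import GRing.Theory.
Local Open Scope ring_scope.

(** Write [Q = (x_i^(a i), i in A)], [Q' = (x_j^(b j), j in B)] and
    [I = Q :&: Q'].  It suffices to find one number [d0] that bounds from above
    the length of every [I]-regular sequence in the graded maximal ideal, and
    from below the Stanley depth of one explicit decomposition of [I]
    ([stanley_inequality_from_bounds]).

    Upper bound for the depth.  If [I] has a regular sequence of length [r] in
    the maximal ideal, the Koszul cohomology of [I] with respect to all the
    variables vanishes in degrees below [r] ([koszul_vanishing]): the members
    of the sequence act as zero on this cohomology, so one can climb down the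
    sequence one degree at a time.  Hence a nonzero cohomology class in degree
    [d0] bounds the depth by [d0].  A class for the variables in a set [T]
    becomes a class for all the variables when it is multiplied by the other
    [n - #|T|] generators of the Koszul complex ([ktop_boundary]).  This gives
    two bounds.
    - If a monomial [x^s] in the variables of [T] is not in [I] but [x_i x^s]
      is in [I] for all [i] in [T], the Koszul differential of [x^s] is a class
      of degree 1, and [d0 = n - #|T| + 1] ([depth_bound_socle]).
    - If [A] and [B] are not nested, take [T = A :|: B] and for [x^s] the socle
      monomial of [S / (Q + Q')]: the connecting homomorphisms
      of 0 -> S/I -> S/Q + S/Q' -> S/(Q+Q') -> 0 and of 0 -> I -> S -> S/I -> 0
      send it to a class of degree 2, and [d0 = n - #|T| + 2]
      ([depth_bound_two]).

    Lower bound for the Stanley depth.  Let [Y] be a set of variables such that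
    fixing all the exponents outside [Y] always cuts out of the monomials of
    [I] the monomials of a principal ideal in the variables of [Y].  Cutting [I]
    in this way, where exponents beyond those of the generators are not told
    apart, gives a Stanley decomposition whose pieces are free at least in the
    directions of [Y] and of the variables that do not occur in the generators
    ([stanley_decomposition_box]).  A single variable always has this property,
    and in the case where [A] and [B] are not nested so does a pair consisting
    of a variable of [A] not in [B] and one of [B] not in [A].

    If [A] and [B] are nested, say [A \subset B], then either the corner
    monomial of [Q'] lies in [Q] and is the required [x^s] for [T = B], or
    [I = Q], which is irreducible with [T = A]. *)

(** * The Koszul complex and regular sequences *)

Section Koszul.
Variables (R : comNzRingType) (y : nat -> R).

(** Koszul cochains with respect to [y 0, .., y l.-1], built one variable at a
    time as a mapping cone: [(c1, c2)] stands for [c1 + e_l c2], where [e_l] is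
    the exterior generator of the last variable.  No signs of permutations
    enter in this way. *)
Fixpoint koszul (l : nat) : lmodType R :=
  if l is l'.+1 then (koszul l' * koszul l')%type else R^o.

Fixpoint kdiff l : koszul l -> koszul l :=
  if l is l'.+1 then fun c => (kdiff c.1, y l' *: c.1 - kdiff c.2) else fun=> 0.

(** The contraction against the linear form with coefficients [a]. *)
Fixpoint kcontract (a : nat -> R) l : koszul l -> koszul l :=
  if l is l'.+1 then fun c =>
    (a l' *: c.2 + kcontract a c.1, - kcontract a c.2) else fun=> 0.

Fixpoint kentries (P : R -> Prop) l : koszul l -> Prop :=
  if l is l'.+1 then fun c => kentries P c.1 /\ kentries P c.2 else P.

(** The degree is shifted by one: [kdeg p c] says that [c] is a cochain of
    degree [p - 1].  So [kdeg 0 c] means [c = 0], and a contraction of a cochain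
    of degree 0 still has a degree. *)
Fixpoint kdeg l (p : nat) : koszul l -> Prop :=
  if l is l'.+1 then
    fun c => kdeg p c.1 /\ (if p is p'.+1 then kdeg p' c.2 else c.2 = 0)
  else fun c => if p == 1%N then True else c = 0.

Lemma kdiff_is_linear l : linear (@kdiff l).
Proof.
elim: l => [|l IH] a u v /=; first by rewrite scaler0 addr0.
congr pair => /=; first exact: IH.
by rewrite IH scalerDr scalerBr opprD !scalerA mulrC addrACA.
Qed.
HB.instance Definition _ l :=
  GRing.isLinear.Build R (koszul l) (koszul l) *:%R (@kdiff l) (@kdiff_is_linear l).

Lemma kcontract_is_linear a l : linear (@kcontract a l).
Proof.
elim: l => [|l IH] b u v /=; first by rewrite scaler0 addr0.
congr pair => /=; rewrite IH.
  by rewrite !scalerDr !scalerA (mulrC b) addrACA.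
by rewrite opprD scalerN.
Qed.
HB.instance Definition _ a l :=
  GRing.isLinear.Build R (koszul l) (koszul l) *:%R (@kcontract a l)
    (@kcontract_is_linear a l).

Lemma kdiff_kdiff l (c : koszul l) : kdiff (kdiff c) = 0.
Proof.
elim: l c => //= l IH c; rewrite linearB linearZ /= !IH subr0.
by rewrite subrr.
Qed.

(** Cartan's formula: every element of the ideal of the [y i] acts on the
    Koszul complex as a map homotopic to zero. *)
Lemma koszul_homotopy (a : nat -> R) l (c : koszul l) :
  kdiff (kcontract a c) + kcontract a (kdiff c) = (\sum_(i < l) a i * y i) *: c.
Proof.
elim: l c => [|l IH] c; first by rewrite big_ord0 scale0r addr0.
rewrite big_ord_recr /=.
transitivity (kdiff (kcontract a c.1) + kcontract a (kdiff c.1) + (a l * y l) *: c.1,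
              kdiff (kcontract a c.2) + kcontract a (kdiff c.2) +
                (a l * y l) *: c.2); last first.
  by rewrite !IH -!scalerDl.
congr pair => /=.
  rewrite linearD linearZ /= scalerBr scalerA.
  set u := a l *: kdiff c.2; set v := kdiff (kcontract a c.1);
    set w := kcontract a (kdiff c.1).
  by rewrite addrACA [u + _]addrC subrK addrC.
rewrite linearN linearB linearZ /= scalerDr scalerA (mulrC (y l)) !opprK.
rewrite opprB; set u := kdiff (kcontract a c.2); set v := kcontract a (kdiff c.2).
set w := y l *: _.
by rewrite [X in X + _]addrAC [v - w]addrC addrA addrK [RHS]addrC addrA.
Qed.

Definition is_ideal (P : R -> Prop) :=
  P 0 /\ forall a u v, P u -> P v -> P (a * u + v).

Lemma is_idealD P u v : is_ideal P -> P u -> P v -> P (u + v).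
Proof. by move=> [_ PD] Pu Pv; rewrite -(mul1r u); apply: PD. Qed.

Lemma is_idealM P a u : is_ideal P -> P u -> P (a * u).
Proof. by move=> [P0 PD] Pu; rewrite -(addr0 (a * u)); apply: PD. Qed.

Lemma kentriesP P l : is_ideal P -> forall a (u v : koszul l),
  kentries P u -> kentries P v -> kentries P (a *: u + v).
Proof.
move=> [_ PD]; elim: l => [|l IH] a u v /=; first exact: PD.
by move=> [u1 u2] [v1 v2]; split; apply: IH.
Qed.

Lemma kentries0 P l : is_ideal P -> kentries P (0 : koszul l).
Proof. by move=> [P0 _]; elim: l => //= l IH; split. Qed.

Lemma kentriesD P l (u v : koszul l) :
  is_ideal P -> kentries P u -> kentries P v -> kentries P (u + v).
Proof. by move=> Pl Pu Pv; rewrite -(scale1r u); apply: kentriesP. Qed.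

Lemma kentriesZ P l a (u : koszul l) : is_ideal P -> kentries P u -> kentries P (a *: u).
Proof.
by move=> Pl Pu; rewrite -(addr0 (a *: u)); apply: kentriesP => //; apply: kentries0.
Qed.

Lemma kentriesN P l (u : koszul l) : is_ideal P -> kentries P u -> kentries P (- u).
Proof. by move=> Pl; rewrite -scaleN1r; apply: kentriesZ. Qed.

Lemma kentriesB P l (u v : koszul l) :
  is_ideal P -> kentries P u -> kentries P v -> kentries P (u - v).
Proof. by move=> Pl Pu Pv; apply: kentriesD => //; apply: kentriesN. Qed.

Lemma kentries_kdiff P l (c : koszul l) : is_ideal P -> kentries P c ->
  kentries P (kdiff c).
Proof.
move=> Pl; elim: l c => [|l IH] c /=; first by case: Pl.
by move=> [c1 c2]; split; [|apply: kentriesB => //]; [| apply: kentriesZ|]; auto.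
Qed.

Lemma kentries_kcontract P a l (c : koszul l) : is_ideal P -> kentries P c ->
  kentries P (kcontract a c).
Proof.
move=> Pl; elim: l c => [|l IH] c /=; first by case: Pl.
move=> [c1 c2]; split; last by apply: kentriesN; auto.
by apply: kentriesP; auto.
Qed.

Lemma kdeg0E l (c : koszul l) : kdeg 0 c -> c = 0.
Proof. by elim: l c => //= l IH [c1 c2] /= [/IH-> ->]. Qed.

Lemma kdeg_0 l p : kdeg p (0 : koszul l).
Proof. by elim: l p => [|l IH] [|p] //=; case: p. Qed.

Lemma kdegP l p a (u v : koszul l) : kdeg p u -> kdeg p v -> kdeg p (a *: u + v).
Proof.
elim: l p u v => [|l IH] p u v /=.
  by case: ifP => // _ -> ->; rewrite scaler0 addr0.
move=> [u1 u2] [v1 v2]; split; first exact: IH.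
by case: p u1 v1 u2 v2 => [_ _ -> ->|p _ _]; [rewrite scaler0 addr0|apply: IH].
Qed.

Lemma kdegZ l p a (u : koszul l) : kdeg p u -> kdeg p (a *: u).
Proof. by move=> pu; rewrite -(addr0 (a *: u)); apply/kdegP/kdeg_0. Qed.

Lemma kdegB l p (u v : koszul l) : kdeg p u -> kdeg p v -> kdeg p (u - v).
Proof. by move=> pu pv; rewrite addrC -scaleN1r; apply: kdegP. Qed.

Lemma kdeg_kdiff l p (c : koszul l) : kdeg p c -> kdeg p.+1 (kdiff c).
Proof.
elim: l p c => [|l IH] p c /=; first by case: p.
move=> [c1 c2]; split; first exact: IH.
case: p c1 c2 => [c1 ->|p c1 c2].
  by rewrite (kdeg0E c1) scaler0 linear0 subr0; apply: kdeg_0.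
by apply: kdegB; [apply: kdegZ | apply: IH].
Qed.

Lemma kdeg_kcontract a l p (c : koszul l) : kdeg p.+1 c -> kdeg p (kcontract a c).
Proof.
elim: l p c => [|l IH] p c /=; first by case: (p == 1%N).
move=> [c1 c2]; split; first by apply: kdegP => //; apply: IH.
case: p c1 c2 => [|p] c1 c2; first by rewrite (kdeg0E c2) linear0 oppr0.
by rewrite -scaleN1r; apply/kdegZ/IH.
Qed.

(** With [N' = f I + N], as for consecutive members of a regular sequence.  The
    degree is kept because entries that the degree forces to vanish can be split
    trivially. *)
Lemma kentries_split (I N N' : R -> Prop) f l p (c : koszul l) :
  is_ideal I -> is_ideal N ->
  (forall g, N' g -> exists u v, [/\ I u, N v & g = f * u + v]) ->
  kentries N' c -> kdeg p c ->
  exists u v, [/\ kentries I u, kdeg p u, kentries N v & c = f *: u + v].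
Proof.
move=> Il Nl NN'; elim: l p c => [|l IH] p c /=.
  case: ifP => _ cN' cp; last first.
    by exists 0, 0; rewrite cp scaler0 addr0; split=> //; [case: Il|case: Nl].
  by have [u [v [? ? ->]]] := NN' _ cN'; exists u, v.
move=> [c1 c2] [p1 p2].
have [u1 [v1 [Iu1 du1 Nv1 e1]]] := IH _ _ c1 p1.
suff [u2 [v2 [Iu2 du2 Nv2 e2]]] : exists u v, [/\ kentries I u,
    (if p is p'.+1 then kdeg p' u else u = 0), kentries N v & c.2 = f *: u + v].
  by exists (u1, u2), (v1, v2); split=> //; case: c e1 e2 {c1 c2 p1 p2} => /= ? ? -> ->.
case: p p1 p2 {du1} => [|p] p1 p2; last exact: IH.
by exists 0, 0; rewrite p2 scaler0 addr0; split=> //; apply: kentries0.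
Qed.

Lemma kentries_merge (I N N' : R -> Prop) f l (u v : koszul l) : is_ideal N ->
  (forall g, (exists u v, [/\ I u, N v & g = f * u + v]) -> N' g) ->
  kentries I u -> kentries N v -> kentries N' (f *: u - v).
Proof.
move=> Nl NN'; elim: l u v => [|l IH] u v /=.
  move=> Iu Nv; apply: NN'; exists u, (- v); split=> //.
  by rewrite -mulN1r; apply: is_idealM.
by move=> [? ?] [? ?]; split; apply: IH.
Qed.

Lemma kentries_regular (I N : R -> Prop) f l (c : koszul l) :
  (forall g, I g -> N (f * g) -> N g) ->
  kentries I c -> kentries N (f *: c) -> kentries N c.
Proof.
move=> reg; elim: l c => [|l IH] c /=; first exact: reg.
by move=> [? ?] [? ?]; split; apply: IH.
Qed.

Lemma kentries_mono (P P' : R -> Prop) l (c : koszul l) :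
  (forall g, P g -> P' g) -> kentries P c -> kentries P' c.
Proof. by move=> PP'; elim: l c => [|l IH] c /=; [auto|move=> []; split; auto]. Qed.

(** Here [N k = (f_0, .., f_(k-1)) I].  Let [c] be a cocycle of degree below
    [r - k] over [I / N k], and [h] the contraction for [f_k].  Then
    [f_k c = d (h c)] modulo [N k], so [h c] is a cocycle over [I / N (k + 1)]
    of smaller degree and thus a coboundary there: [h c = d e + f_k u] modulo
    [N k].  Applying [d] gives [f_k c = f_k (d u)] modulo [N k], and [f_k] can
    be cancelled by regularity. *)
Lemma koszul_vanishing l (I : R -> Prop) (N : nat -> R -> Prop) (f : nat -> R) r :
  is_ideal I -> (forall k, is_ideal (N k)) ->
  (forall k, (k < r)%N -> forall g, I g -> N k (f k * g) -> N k g) ->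
  (forall k, (k < r)%N -> forall g,
     N k.+1 g <-> exists u v, [/\ I u, N k v & g = f k * u + v]) ->
  (forall k, (k < r)%N -> exists a : nat -> R, f k = \sum_(i < l) a i * y i) ->
  forall j k p (c : koszul l), (k + j = r)%N -> (p <= j)%N ->
    kentries I c -> kdeg p c -> kentries (N k) (kdiff c) ->
  exists e, [/\ kentries I e, kdeg p.-1 e & kentries (N k) (c - kdiff e)].
Proof.
move=> Il Nl reg NS fy; elim=> [|j IH] k [|p] c // kj lepj Ic dc Ndc.
- exists 0; rewrite (kdeg0E dc) linear0 subr0.
  by split; [apply: kentries0 | apply: kdeg_0 | apply: kentries0].
- exists 0; rewrite (kdeg0E dc) linear0 subr0.
  by split; [apply: kentries0 | apply: kdeg_0 | apply: kentries0].
have ltkr : (k < r)%N by rewrite -kj addnS ltnS leq_addr.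
have [a fa] := fy k ltkr; have := koszul_homotopy a c; rewrite -fa => hc.
have Nh : kentries (N k) (kcontract a (kdiff c)) by apply: kentries_kcontract.
(* [h c] is a cocycle modulo [N k.+1], in a degree lower by one. *)
have Nd : kentries (N k.+1) (kdiff (kcontract a c)).
  have -> : kdiff (kcontract a c) = f k *: c - kcontract a (kdiff c) by rewrite -hc addrK.
  by apply: kentries_merge Ic Nh => // g; apply: (NS k ltkr g).2.
have [||e [Ie de Ne]] := IH k.+1 p (kcontract a c) _ lepj _ (kdeg_kcontract a dc) Nd.
- by rewrite addSnnS.
- exact: kentries_kcontract.
have dx : kdeg p (kcontract a c - kdiff e).
  apply: kdegB; first exact: kdeg_kcontract.
  case: p lepj dc de => [|p] lepj dc de; last exact: kdeg_kdiff.
  by rewrite (kdeg0E de) linear0; apply: kdeg_0.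
have [u [v [Iu du Nv xE]]] := kentries_split Il (Nl k) (fun g => (NS k ltkr g).1) Ne dx.
exists u; split=> //; apply: kentries_regular (reg k ltkr) _ _.
  by apply: kentriesB => //; apply: kentries_kdiff.
suff -> : f k *: (c - kdiff u) = kcontract a (kdiff c) + kdiff v.
  by apply: kentriesD => //; apply: kentries_kdiff.
have fu : f k *: u = kcontract a c - kdiff e - v by rewrite xE addrK.
have -> : f k *: (c - kdiff u) = f k *: c - kdiff (f k *: u) by rewrite linearZ scalerBr.
rewrite fu !linearB /= kdiff_kdiff -hc !opprK addr0.
by rewrite addrA [X in X + _]addrAC subrr add0r.
Qed.

End Koszul.

(** * Cohomology classes in low degree *)

Section KoszulClasses.
Variables (R : comNzRingType) (y : nat -> R).

(** The exterior product with the generators of the last [r] variables. *)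
Fixpoint ktop t r (c : koszul R t) : koszul R (r + t) :=
  if r is r'.+1 then (0, ktop r' c) else c.

Lemma kdiff_ktop t r (c : koszul R t) : kdiff y c = 0 -> kdiff y (ktop r c) = 0.
Proof.
by move=> c0; elim: r => //= r IH; rewrite IH linear0 scaler0 subr0.
Qed.

Lemma kdeg_ktop t r p (c : koszul R t) : kdeg p c -> kdeg (r + p) (ktop r c).
Proof. by move=> dc; elim: r => //= r IH; split=> //; apply: kdeg_0. Qed.

Lemma kentries_ktop P t r (c : koszul R t) : is_ideal P -> kentries P c ->
  kentries P (ktop r c).
Proof. by move=> Pl Pc; elim: r => //= r IH; split=> //; apply: kentries0. Qed.

Lemma kentries_scale P l a (c : koszul R l) : is_ideal P -> P a -> kentries P (a *: c).
Proof.
move=> Pl Pa; elim: l c => [|l IH] c /=; last by split.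
by rewrite /GRing.scale /= mulrC; apply: is_idealM.
Qed.

(** Modulo an ideal [J] that contains the last [r] variables, the last
    component of a coboundary is, up to sign, the coboundary of the last
    component. *)
Lemma ktop_boundary (I J : R -> Prop) t r p (c : koszul R t) (e : koszul R (r + t)) :
  is_ideal I -> is_ideal J -> (forall i, (i < r)%N -> J (y (i + t))) ->
  kentries I e -> kdeg (r + p) e -> kentries J (ktop r c - kdiff y e) ->
  exists e', [/\ kentries I e', kdeg p e' & kentries J (c - kdiff y e')].
Proof.
move=> Il Jl; elim: r e => [|r IH] e Jy Ie de /=; first by exists e.
move=> [_ Jc]; case: Ie de => [_ Ie] [_ de].
apply: (IH (- e.2)) => [i ltir||| ]; first by apply: Jy; apply: ltnW.
- exact: kentriesN.
- by rewrite -scaleN1r; apply: kdegZ.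
have -> : ktop r c - kdiff y (- e.2) =
    (ktop r c - (y (r + t) *: e.1 - kdiff y e.2)) + y (r + t) *: e.1.
  by rewrite linearN /= opprK opprB addrA -[RHS]addrA addNr addr0.
by apply: kentriesD => //; apply: kentries_scale => //; apply: Jy.
Qed.

Fixpoint kcochain0 l (s : R) : koszul R l := if l is l'.+1 then (kcochain0 l' s, 0) else s.

Fixpoint kcochain1 l (w : nat -> R) : koszul R l :=
  if l is l'.+1 then (kcochain1 l' w, kcochain0 l' (w l')) else 0.

Lemma kcochain1_ext l w v : (forall i, (i < l)%N -> w i = v i) ->
  kcochain1 l w = kcochain1 l v.
Proof.
by elim: l => //= l IH wv; rewrite IH ?wv // => i il; rewrite wv // ltnW.
Qed.

Lemma kcochain0Z l a s : kcochain0 l (a * s) = a *: kcochain0 l s.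
Proof. by elim: l => //= l ->; congr pair; rewrite /= scaler0. Qed.

Lemma kcochain0B l u v : kcochain0 l (u - v) = kcochain0 l u - kcochain0 l v.
Proof. by elim: l => //= l ->; congr pair; rewrite /= subr0. Qed.

Lemma kcochain1Z l a w : kcochain1 l (fun i => a * w i) = a *: kcochain1 l w.
Proof.
by elim: l => [|l IH] /=; [rewrite scaler0 | congr pair; rewrite ?IH ?kcochain0Z].
Qed.

Lemma kcochain1B l w v : kcochain1 l (fun i => w i - v i) = kcochain1 l w - kcochain1 l v.
Proof.
by elim: l => [|l IH] /=; [rewrite subr0 | congr pair; rewrite ?IH ?kcochain0B].
Qed.

Lemma kdiff_kcochain0 l s : kdiff y (kcochain0 l s) = kcochain1 l (fun i => y i * s).
Proof. by elim: l => //= l ->; congr pair; rewrite linear0 subr0 -kcochain0Z. Qed.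

Lemma kdiff_kcochain1 l w : kdiff y (kcochain1 l.+1 w) =
  (kdiff y (kcochain1 l w), kcochain1 l (fun i => y l * w i - y i * w l)).
Proof. by rewrite /= kdiff_kcochain0 -kcochain1Z -kcochain1B. Qed.

Lemma kentries_kcochain0 P l s : is_ideal P -> kentries P (kcochain0 l s) <-> P s.
Proof.
move=> Pl; elim: l => //= l IH; split=> [[/IH]//|Ps].
by split; [apply/IH | apply: kentries0].
Qed.

Lemma kentries_kcochain1 P l w : is_ideal P ->
  kentries P (kcochain1 l w) <-> (forall i, (i < l)%N -> P (w i)).
Proof.
move=> Pl; elim: l => /= [|l IH]; first by split=> // _; case: Pl.
split=> [[/IH Pw /(kentries_kcochain0 _ _ Pl) Pl'] i|Pw].
  by rewrite ltnS leq_eqVlt => /orP [/eqP ->|/Pw].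
by split; [apply/IH => i il; apply/Pw/ltnW | apply/kentries_kcochain0 => //; apply: Pw].
Qed.

Lemma kentries_kdiff_kcochain1 P l w : is_ideal P ->
  kentries P (kdiff y (kcochain1 l w)) <->
  (forall i j, (i < j < l)%N -> P (y j * w i - y i * w j)).
Proof.
move=> Pl; elim: l => [|l IH]; first by split=> [? i j|_]; [rewrite andbF|case: Pl].
rewrite kdiff_kcochain1; split=> [/= [/IH Pw /(kentries_kcochain1 _ _ Pl) Pwl] i j|Pw].
  rewrite ltnS [(j <= l)%N]leq_eqVlt => /andP [ij /orP [/eqP jl|jl]].
    by subst j; apply: Pwl.
  by apply: Pw; rewrite ij.
split.
  by apply/IH => i j /andP [ij jl]; apply: Pw; rewrite ij ltnW.
by apply/kentries_kcochain1 => // i il; apply: Pw; rewrite il /=.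
Qed.

Lemma kdeg_kcochain0 l s : kdeg 1 (kcochain0 l s).
Proof. by elim: l => //= l IH; split=> //; apply: kdeg_0. Qed.

Lemma kdeg_kcochain1 l w : kdeg 2 (kcochain1 l w).
Proof. by elim: l => //= l IH; split=> //; apply: kdeg_kcochain0. Qed.

Lemma kdeg1E l (c : koszul R l) : kdeg 1 c -> exists s, c = kcochain0 l s.
Proof.
elim: l c => [|l IH] c; first by exists c.
case: c => c1 c2 [/= /IH [s ->] /kdeg0E ->].
by exists s.
Qed.

Lemma kdeg2E l (c : koszul R l) : kdeg 2 c -> exists w, c = kcochain1 l w.
Proof.
elim: l c => [|l IH] c /=; first by move->; exists (fun=> 0).
case: c => c1 c2 [/= /IH [w ->] /kdeg1E [s ->]].
exists (fun i => if i == l then s else w i); rewrite eqxx; congr pair.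
by apply: kcochain1_ext => i il; rewrite ltn_eqF.
Qed.

(** A cocycle in the first [t] variables, of degree [p], becomes a coboundary
    modulo the other [r] variables as soon as [I] has a regular sequence longer
    than [r + p].  So a cocycle that does not do so bounds the depth. *)
Lemma koszul_class_bounds t r p (I J : R -> Prop) (N : nat -> R -> Prop)
    (f : nat -> R) k (c : koszul R t) :
  is_ideal I -> (forall k, is_ideal (N k)) -> (forall g, N 0%N g -> g = 0) ->
  (forall i, (i < k)%N -> forall g, I g -> N i (f i * g) -> N i g) ->
  (forall i, (i < k)%N -> forall g,
     N i.+1 g <-> exists u v, [/\ I u, N i v & g = f i * u + v]) ->
  (forall i, (i < k)%N -> exists a : nat -> R, f i = \sum_(j < r + t) a j * y j) ->
  is_ideal J -> (forall i, (i < r)%N -> J (y (i + t))) ->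
  kentries I c -> kdeg p.+1 c -> kdiff y c = 0 -> (r + p < k)%N ->
  exists e, [/\ kentries I e, kdeg p e & kentries J (c - kdiff y e)].
Proof.
move=> Il Nl N0 reg NS fy Jl Jy Ic dc c0 ltk.
have := @koszul_vanishing _ y (r + t) I N f k Il Nl reg NS fy k 0 (r + p.+1) (ktop r c).
case=> //; first by rewrite addnS.
- exact: kentries_ktop.
- exact: kdeg_ktop.
- by rewrite kdiff_ktop //; apply: kentries0.
rewrite addnS => e [Ie de Ne]; apply: ktop_boundary Ie de _ => //.
by apply: kentries_mono Ne => g /N0 ->; case: Jl.
Qed.

End KoszulClasses.

(** * Monomial ideals and bounds for their depth *)

Section MonomialIdeals.
Variables (K : fieldType) (n : nat).
Local Notation S := {mpoly K[n]}.
Implicit Types (M : pred 'X_{1..n}) (m s : 'X_{1..n}) (T : {set 'I_n})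
  (fs : seq S) (I : S -> Prop).

Definition upclosed M := forall m k, M m -> M (m + k)%MM.

Definition mideal M (f : S) : Prop := forall m, m \in msupp f -> M m.

Lemma addmCA m1 m2 m3 : (m1 + (m2 + m3) = m2 + (m1 + m3))%MM.
Proof. by rewrite !addmA [(m1 + m2)%MM]addmC. Qed.

Lemma upclosed_le M m k : upclosed M -> (m <= k)%MM -> M m -> M k.
Proof. by move=> Mu mk Mm; rewrite -(submK mk) addmC; apply: Mu. Qed.

Lemma mideal_is_ideal M : upclosed M -> is_ideal (mideal M).
Proof.
move=> Mu; split=> [m|a u v Iu Iv m]; first by rewrite msupp0.
move=> /msuppD_le; rewrite mem_cat => /orP [/msuppM_le|/Iv //].
by case/allpairsP => -[m1 m2] [_ /Iu Mm2 ->]; rewrite addmC; apply: Mu.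
Qed.

Lemma midealX M m : mideal M 'X_[m] <-> M m.
Proof.
split=> [|Mm k]; first by apply; rewrite msuppX inE.
by rewrite msuppX inE => /eqP ->.
Qed.

Lemma mideal_coef0 M (f : S) m : mideal M f -> ~~ M m -> f@_m = 0.
Proof. by move=> If; apply: contraNeq; rewrite -mcoeff_msupp => /If. Qed.

Lemma mcoeffXM (f : S) m k : ('X_[m] * f)@_(m + k) = f@_k.
Proof. by rewrite mulrC mcoeffMX. Qed.

Lemma seq_mulP fs (I : S -> Prop) g : seq_mul_ideal fs I g <->
  exists h : nat -> S, (forall j, (j < size fs)%N -> I (h j)) /\
    g = \sum_(j < size fs) fs`_j * h j.
Proof.
split=> [[h [Ih ->]]|[h [Ih ->]]]; last first.
  by exists (fun j => h j); split=> // j; apply: Ih.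
exists (fun j => if insub j is Some i then h i else 0); split=> [j ltj|].
  by rewrite insubT.
by apply: eq_bigr => j _; rewrite insubT //= => ltj; congr (_ * h _); apply: val_inj.
Qed.

Lemma seq_mul_is_ideal fs I : is_ideal I -> is_ideal (seq_mul_ideal fs I).
Proof.
move=> Il; split=> [|a u v [hu [Iu ->]] [hv [Iv ->]]].
  exists (fun=> 0); split=> [_|]; first by case: Il.
  by rewrite big1 // => j _; rewrite mulr0.
exists (fun j => a * hu j + hv j); split=> [j|]; first by case: Il => _; apply.
rewrite mulr_sumr -big_split; apply: eq_bigr => j _ /=.
by rewrite mulrDr !mulrA (mulrC a).
Qed.

Lemma seq_mul0 I g : seq_mul_ideal [::] I g -> g = 0.
Proof. by case=> h [_ ->]; rewrite big_ord0. Qed.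

Lemma seq_mul_take fs I k g : (k < size fs)%N ->
  seq_mul_ideal (take k.+1 fs) I g <->
  exists u v, [/\ I u, seq_mul_ideal (take k fs) I v & g = fs`_k * u + v].
Proof.
move=> ltk; have sz : size (take k.+1 fs) = k.+1 by rewrite size_takel.
have sz' : size (take k fs) = k by rewrite size_takel // ltnW.
split.
  move/seq_mulP; rewrite sz => -[h [Ih ->]].
  exists (h k), (\sum_(j < k) fs`_j * h j); split; first exact: Ih.
    apply/seq_mulP; rewrite sz'; exists h; split=> [j jk|]; first by apply/Ih/ltnW.
    by apply: eq_bigr => j _; rewrite nth_take.
  rewrite big_ord_recr /= nth_take // addrC; congr (_ + _).
  by apply: eq_bigr => j _; rewrite nth_take // ltnS ltnW.
case=> u [v [Iu /seq_mulP]]; rewrite sz' => -[h [Ih ->]] ->.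
apply/seq_mulP; rewrite sz; exists (fun j => if j == k then u else h j).
split=> [j|].
  rewrite ltnS leq_eqVlt; case: eqP => [-> //|_ /=]; exact: Ih.
rewrite big_ord_recr /= eqxx nth_take // addrC; congr (_ + _).
apply: eq_bigr => j _; rewrite !nth_take //; last by rewrite ltnS ltnW.
by rewrite ltn_eqF.
Qed.

(** The variables of [T] come first, so that those outside [T] are the ones that
    [ktop] adds. *)
Definition vars T (i : nat) : S := [seq 'X_j | j <- enum T ++ enum (~: T)]`_i.

Lemma card_vars T : (#|~: T| + #|T| = n)%N.
Proof. by rewrite addnC cardsC card_ord. Qed.

Lemma varsP T (i : 'I_n) : exists2 k, (k < #|~: T| + #|T|)%N & vars T k = 'X_i.
Proof.
have iE : i \in enum T ++ enum (~: T) by rewrite mem_cat !mem_enum inE orbN.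
exists (index i (enum T ++ enum (~: T))).
  by move: iE; rewrite -index_mem size_cat -!cardE addnC.
by rewrite /vars (nth_map i) ?index_mem // nth_index.
Qed.

Lemma vars_in T (i : 'I_n) : i \in T -> exists2 k, (k < #|T|)%N & vars T k = 'X_i.
Proof.
move=> iT; have iE : i \in enum T by rewrite mem_enum.
exists (index i (enum T)); first by rewrite cardE index_mem.
rewrite /vars (nth_map i) ?nth_cat ?index_mem ?iE ?nth_index //.
by rewrite size_cat ltn_addr // index_mem.
Qed.

Lemma vars_lt T k : (k < #|T|)%N -> exists2 i, i \in T & vars T k = 'X_i.
Proof.
move=> ltk; pose i := enum_val (Ordinal ltk); exists i; first exact: enum_valP.
rewrite /vars (nth_map i) ?size_cat -?cardE ?ltn_addr // nth_cat -cardE ltk.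
by rewrite [in RHS]/i (enum_val_nth i).
Qed.

Lemma vars_ge T k : (k < #|~: T|)%N -> exists2 i, i \notin T & vars T (k + #|T|) = 'X_i.
Proof.
move=> ltk; pose i := enum_val (Ordinal ltk).
exists i; first by rewrite -in_setC; apply: enum_valP.
rewrite /vars (nth_map i) ?size_cat -?cardE ?[(#|T| + _)%N]addnC ?ltn_add2r //.
rewrite nth_cat -cardE ltnNge leq_addl /= addnK.
by rewrite [in RHS]/i (enum_val_nth i).
Qed.

Lemma maximal_ideal_vars T f : graded_maximal_ideal f ->
  exists a : nat -> S, f = \sum_(i < #|~: T| + #|T|) a i * vars T i.
Proof.
case=> r [c [g [Xg ->]]].
elim: r c g Xg => [|r IH] c g Xg.
  by exists (fun=> 0); rewrite big_ord0 big1 // => i _; rewrite mul0r.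
rewrite big_ord_recr /=.
have [a ->] :=
  IH (fun i => c (widen_ord (leqnSn r) i)) (fun i => g (widen_ord (leqnSn r) i))
     (fun i => Xg _).
have [i ->] := Xg ord_max; have [k ltk <-] := varsP T i.
exists (fun i => a i + (if i == k then c ord_max else 0)).
rewrite [RHS](eq_bigr (fun i : 'I_ _ =>
  a i * vars T i + (if i == Ordinal ltk then c ord_max * vars T i else 0))).
  by rewrite big_split -big_mkcond /= big_pred1_eq.
by move=> j _; rewrite mulrDl; congr (_ + _); rewrite -val_eqE /=; case: eqP;
  rewrite ?mul0r.
Qed.

(** The monomials of the ideal generated by the variables that are not in
    [T]. *)
Definition outside T : pred 'X_{1..n} := fun m => [exists i in ~: T, (0 < m i)%N].

Lemma outside_up T : upclosed (outside T).
Proof.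
move=> m k /existsP [i /andP [iT mi]]; apply/existsP; exists i; rewrite iT /=.
by rewrite mnmDE ltn_addr.
Qed.

Lemma regular_seq_class (I : S -> Prop) T fs p (c : koszul _ #|T|) :
  is_ideal I -> regular_seq I fs -> (forall f, f \in fs -> graded_maximal_ideal f) ->
  kentries I c -> kdeg p.+1 c -> kdiff (vars T) c = 0 -> (n - #|T| + p < size fs)%N ->
  exists e, [/\ kentries I e, kdeg p e &
    kentries (mideal (outside T)) (c - kdiff (vars T) e)].
Proof.
move=> Il [reg _] fsm Ic dc c0 ltp.
apply: (@koszul_class_bounds _ (vars T) #|T| #|~: T| p I _
  (fun k => seq_mul_ideal (take k fs) I) (fun k => fs`_k) (size fs)) => //.
- by move=> k; apply: seq_mul_is_ideal.
- by move=> g; rewrite take0; apply: seq_mul0.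
- by move=> k ltk g; apply: seq_mul_take.
- by move=> k ltk; apply/maximal_ideal_vars/fsm/mem_nth.
- exact/mideal_is_ideal/outside_up.
- move=> i /vars_ge [j jT ->]; apply/midealX; apply/existsP; exists j.
  by rewrite inE jT mnm1E eqxx.
- by rewrite -[X in (X - _)%N](card_vars T) addnK in ltp.
Qed.

Lemma outside_supp T m : (forall i, i \notin T -> m i = 0%N) -> ~~ outside T m.
Proof.
by move=> mT; apply/existsPn => i; rewrite inE; apply/negP => /andP [/mT ->].
Qed.

(** The differential of [x^s] is a cocycle over [I].  If it were the coboundary
    of some [u] in [I] modulo the variables outside [T], then for [t] in [T] the
    coefficient of [x_t x^s] in [x_t x^s - x_t u] would vanish; but it is 1,
    since [x^s] does not occur in [u]. *)
Lemma depth_bound_socle (I : S -> Prop) M T s fs :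
  upclosed M -> (forall f, I f <-> mideal M f) ->
  T != set0 -> (forall i, i \notin T -> s i = 0%N) ->
  ~~ M s -> (forall i, i \in T -> M (s + U_(i))%MM) ->
  regular_seq I fs -> (forall f, f \in fs -> graded_maximal_ideal f) ->
  (size fs <= n - #|T| + 1)%N.
Proof.
move=> Mu IM /set0Pn [t tT] sT Ms MsU reg fsm; rewrite leqNgt; apply/negP => lts.
have Il : is_ideal I.
  have [I0 ID] := mideal_is_ideal Mu; split; first exact/IM.
  by move=> a u v /IM Iu /IM Iv; apply/IM/ID.
have [||| e [Ie de Je]] :=
  @regular_seq_class I T fs 1 (kdiff (vars T) (kcochain0 _ 'X_[s])) Il reg fsm _ _ _ lts.
- rewrite kdiff_kcochain0; apply/kentries_kcochain1 => // i /vars_lt [j jT ->].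
  by rewrite -mpolyXD; apply/IM/midealX; rewrite addmC; apply: MsU.
- exact/kdeg_kdiff/kdeg_kcochain0.
- exact: kdiff_kdiff.
have [u eE] := kdeg1E de; move: Ie Je; rewrite {}eE => /(kentries_kcochain0 _ _ Il) Iu.
rewrite !kdiff_kcochain0 -kcochain1B => /(kentries_kcochain1 _ _
  (mideal_is_ideal (@outside_up T))).
have [k ltk kE] := vars_in tT; move=> /(_ k ltk); rewrite kE => J.
have : ~~ outside T (U_(t) + s)%MM.
  apply: outside_supp => i iT; rewrite mnmDE sT // mnm1E.
  by rewrite (_ : t == i = false) //; apply: contraNF iT => /eqP <-.
move/(mideal_coef0 J)/eqP; rewrite mcoeffB !mcoeffXM mcoeffX eqxx.
by rewrite (mideal_coef0 ((IM u).1 Iu) Ms) // subr0 oner_eq0.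
Qed.

(** The class is the differential of the 1-cochain [w] with [w_i = x_i x^s] if
    this is in the second ideal and [w_i = 0] otherwise.  It has entries in [I]
    because every [x_i x^s] lies in one of the two ideals.  If it were the
    coboundary of a 1-cochain [v] over [I] modulo the variables outside [T],
    then the coefficient of [x_al x_be x^s] in
    [x_al (w_be - v_be) - x_be (w_al - v_al)] would vanish.  But [w_be] is
    [x_be x^s] and [w_al] is zero, while [x_be x^s] does not occur in [v_be] nor
    [x_al x^s] in [v_al], as these monomials are not in [I]; so the coefficient
    is 1. *)
Lemma depth_bound_two (I : S -> Prop) M1 M2 T s al be fs :
  upclosed M1 -> upclosed M2 ->
  (forall f, I f <-> mideal [pred m | M1 m && M2 m] f) ->
  (forall i, i \notin T -> s i = 0%N) ->
  (forall i, i \in T -> M1 (s + U_(i))%MM || M2 (s + U_(i))%MM) ->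
  al \in T -> be \in T -> ~~ M2 (s + U_(al))%MM -> ~~ M1 (s + U_(be))%MM ->
  regular_seq I fs -> (forall f, f \in fs -> graded_maximal_ideal f) ->
  (size fs <= n - #|T| + 2)%N.
Proof.
move=> M1u M2u IM sT MsU alT beT nM2 nM1 reg fsm.
rewrite leqNgt; apply/negP => lts.
have Mu : upclosed [pred m | M1 m && M2 m].
  by move=> m k /andP [? ?]; apply/andP; split; [apply: M1u|apply: M2u].
have Il : is_ideal I.
  have [I0 ID] := mideal_is_ideal Mu; split; first exact/IM.
  by move=> a u v /IM Iu /IM Iv; apply/IM/ID.
pose w k : S := let f := 'X_[s] * vars T k in if all M2 (msupp f) then f else 0.
have wE k i : vars T k = 'X_i ->
  w k = if M2 (s + U_(i))%MM then 'X_[s + U_(i)] else 0.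
  by rewrite /w => ->; rewrite -mpolyXD msuppX /= andbT.
have [||| e [Ie de Je]] :=
  @regular_seq_class I T fs 2 (kdiff (vars T) (kcochain1 _ w)) Il reg fsm _ _ _ lts.
- apply/kentries_kdiff_kcochain1 => // i j /andP [ij jt].
  have [i' iT iE] := vars_lt (ltn_trans ij jt); have [j' jT jE] := vars_lt jt.
  rewrite (wE _ _ iE) (wE _ _ jE) iE jE.
  have M12 u v : u \in T -> v \in T -> M2 (s + U_(u))%MM -> ~~ M2 (s + U_(v))%MM ->
      I ('X_v * 'X_[s + U_(u)]).
    move=> uT vT Mu2 Mv2; rewrite -mpolyXD; apply/IM/midealX => /=.
    rewrite [X in M2 X]addmC M2u // andbT addmCA addmA.
    by have := MsU v vT; rewrite (negbTE Mv2) orbF => /M1u.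
  case: ifPn => Mi; case: ifPn => Mj.
  + rewrite -!mpolyXD [(s + U_(i'))%MM]addmC [(s + U_(j'))%MM]addmC.
    by rewrite addmCA subrr; case: Il.
  + by rewrite mulr0 subr0; apply: M12.
  + rewrite mulr0 sub0r -mulN1r; apply: is_idealM => //; exact: M12.
  + by rewrite !mulr0 subr0; case: Il.
- exact/kdeg_kdiff/kdeg_kcochain1.
- exact: kdiff_kdiff.
have [v eE] := kdeg2E de; move: Ie Je; rewrite {}eE => /(kentries_kcochain1 _ _ Il) Iv.
rewrite -linearB -kcochain1B => /(kentries_kdiff_kcochain1 _ _ _
  (mideal_is_ideal (@outside_up T))).
have [ka lta aE] := vars_in alT; have [kb ltb bE] := vars_in beT.
have neab : al != be.
  by apply: contraNneq nM2 => ab; have := MsU _ beT; rewrite (negbTE nM1) -ab.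
set W := fun i => w i - v i => J.
have {}J : mideal (outside T) ('X_al * W kb - 'X_be * W ka).
  have Jl := mideal_is_ideal (@outside_up T).
  case: (ltngtP ka kb) => [ab|ba|ab].
  - rewrite -opprB -mulN1r; apply: (is_idealM _ Jl).
    by rewrite -aE -bE; apply: J; rewrite ab.
  - by rewrite -aE -bE; apply: J; rewrite ba.
  - move: aE; rewrite ab bE => XE; case/negP: neab.
    have := congr1 (mcoeff U_(be)%MM) XE; rewrite !mcoeffXU eqxx.
    by case: (al == be) => // /eqP; rewrite oner_eq0.
have M2b : M2 (s + U_(be))%MM by have := MsU _ beT; rewrite (negbTE nM1).
have mu : ~~ outside T (U_(al) + (s + U_(be)))%MM.
  apply: outside_supp => i iT; rewrite !mnmDE sT // !mnm1E.
  by rewrite !(_ : forall u, u \in T -> (u == i) = false) // =>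
    u uT; apply: contraNF iT => /eqP <-.
move/eqP: (mideal_coef0 J mu); rewrite mcoeffB mcoeffXM.
have -> : (U_(al) + (s + U_(be)) = U_(be) + (s + U_(al)))%MM.
  by rewrite addmCA addmC -addmA addmCA [(_ + U_(al))%MM]addmC.
rewrite mcoeffXM /W !mcoeffB (wE _ _ aE) (wE _ _ bE) M2b (negbTE nM2).
rewrite mcoeffX eqxx mcoeff0.
rewrite (mideal_coef0 ((IM (v kb)).1 (Iv kb ltb))) /= ?(negbTE nM1) //.
rewrite (mideal_coef0 ((IM (v ka)).1 (Iv ka lta))) /= ?(negbTE nM2) ?andbF //.
by rewrite !subr0 oner_eq0.
Qed.

End MonomialIdeals.

(** * Stanley decompositions of monomial ideals *)

Section StanleyDecompositions.
Variables (K : fieldType) (n : nat).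
Local Notation S := {mpoly K[n]}.
Implicit Types (M : pred 'X_{1..n}) (m z : 'X_{1..n}) (Z Y : {set 'I_n}) (I : S -> Prop).

(** The exponents of the monomials that span the Stanley space
    [x^z K[Z]]. *)
Definition cell z Z : pred 'X_{1..n} :=
  fun m => (z <= m)%MM && [forall j, (j \notin Z) ==> (m j == z j)].

Lemma cellP z Z m : reflect ((z <= m)%MM /\ forall j, j \notin Z -> m j = z j)
  (cell z Z m).
Proof.
apply: (iffP andP) => -[zm mz]; split=> //.
  by move=> j jZ; apply/eqP; have /forallP/(_ j)/implyP/(_ jZ) := mz.
by apply/forallP => j; apply/implyP => jZ; rewrite mz.
Qed.

Lemma cell_base z Z : cell z Z z.
Proof. by apply/cellP; split; first exact: lepm_refl. Qed.

Lemma mideal_sum M (T : Type) (r : seq T) (P : pred T) (F : T -> S) :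
  (forall i, P i -> mideal M (F i)) -> mideal M (\sum_(i <- r | P i) F i).
Proof.
move=> MF; apply: (big_ind (mideal M)) => //; first by move=> m; rewrite msupp0.
by move=> u v Mu Mv m /msuppD_le; rewrite mem_cat => /orP [/Mu|/Mv].
Qed.

Lemma midealZX M (c : K) m : M m -> mideal M (c *: 'X_[m]).
Proof. by move=> Mm k /msuppZ_le; rewrite msuppX inE => /eqP ->. Qed.

Lemma in_zKZP z Z (g : S) : in_zKZ 'X_[z] Z g <-> mideal (cell z Z) g.
Proof.
split=> [[f Zf ->] m|cg].
  rewrite mulrC (perm_mem (msuppMX _ _)) => /mapP [k kf ->].
  apply/cellP; split; first exact: lem_addr.
  by move=> j jZ; rewrite mnmDE (Zf k kf j jZ) addn0.
exists (\sum_(m <- msupp g) g@_m *: 'X_[m - z]).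
  pose P : pred 'X_{1..n} := fun m => [forall i, (i \notin Z) ==> (m i == 0%N)].
  suff PF : mideal P (\sum_(m <- msupp g) g@_m *: 'X_[m - z]).
    by move=> m /PF /forallP Pm i iZ; apply/eqP; move: (Pm i); rewrite iZ.
  rewrite big_seq; apply: mideal_sum => m /cg /cellP [_ mz]; apply: midealZX.
  by apply/forallP => i; apply/implyP => iZ; rewrite mnmBE mz // subnn.
rewrite [LHS]mpolyE mulr_sumr big_seq [RHS]big_seq; apply: eq_bigr => m /cg /cellP [zm _].
by rewrite -scalerAr -mpolyXD addmC submK.
Qed.

Lemma stanley_decomposition_cells I M r (z : 'I_r -> 'X_{1..n}) (Z : 'I_r -> {set 'I_n}) :
  (forall f, I f <-> mideal M f) ->
  (forall i m, cell (z i) (Z i) m -> M m) ->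
  (forall m, M m -> exists i, cell (z i) (Z i) m) ->
  (forall i j m, cell (z i) (Z i) m -> cell (z j) (Z j) m -> i = j) ->
  stanley_decomposition I (fun i => 'X_[z i] : S) Z.
Proof.
move=> IM cM Mc cinj; split=> [i|g|w wZ w0 i].
- split; first by apply/IM/midealX/cM/cell_base.
    by exists 1, (z i); rewrite scale1r.
  move=> f _ /eqP; rewrite mulf_eq0 => /orP [|/eqP //].
  by rewrite -msupp_eq0 msuppX.
- split=> [/IM Mg|[w [wZ ->]]]; last first.
    by apply/IM/mideal_sum => i _ m /((in_zKZP _ _ _).1 (wZ i)) /cM.
  exists (fun i => \sum_(m <- msupp g | cell (z i) (Z i) m) g@_m *: 'X_[m]).
  split=> [i|]; first by apply/in_zKZP/mideal_sum => m; apply: midealZX.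
  rewrite (exchange_big_dep xpredT) //= [LHS]mpolyE big_seq [RHS]big_seq.
  apply: eq_bigr => m /Mg /Mc [i ci]; rewrite (big_pred1 i) // => j /=.
  by apply/idP/eqP => [/cinj/(_ ci)|->].
- apply/mpolyP => m; rewrite mcoeff0.
  have wc j := (in_zKZP _ _ _).1 (wZ j).
  have [ci|] := boolP (cell (z i) (Z i) m); last exact: (mideal_coef0 (wc i)).
  have := congr1 (mcoeff m) w0; rewrite raddf_sum mcoeff0 (bigD1 i) //= big1 ?addr0 //.
  move=> j ji; apply: (mideal_coef0 (wc j)); apply: contraNN ji => cj.
  by apply/eqP/(cinj _ _ _ cj ci).
Qed.

Definition mmin m1 m2 : 'X_{1..n} := [multinom minn (m1 j) (m2 j) | j < n].

(** A generator of the slice of [M] along the directions of [Y] through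
    [z]. *)
Definition lower_corner M Y z := M z /\ forall y, y \in Y -> (0 < z y)%N ->
  ~~ M (z - U_(y))%MM.

(** When [M] is closed under minima along [Y], its slices along [Y] are
    principal: a corner lies below every point of its slice. *)
Lemma lower_corner_le M Y z m : upclosed M ->
  (forall m1 m2, M m1 -> M m2 -> (forall j, j \notin Y -> m1 j = m2 j) -> M (mmin m1 m2)) ->
  lower_corner M Y z -> M m -> (forall j, j \notin Y -> z j = m j) -> (z <= m)%MM.
Proof.
move=> Mu Mmin [Mz zmin] Mm zm; apply/mnm_lepP => y; rewrite leqNgt; apply/negP => lty.
have yY : y \in Y by apply: contraLR lty => /zm ->; rewrite ltnn.
have := zmin y yY (leq_ltn_trans (leq0n _) lty); apply/negP/negPn.
apply: upclosed_le Mu _ (Mmin _ _ Mz Mm zm); apply/mnm_lepP => j.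
rewrite mnmE mnmBE mnm1E; case: eqP => [<-|_]; last by rewrite subn0 geq_minl.
by rewrite geq_min; apply/orP; right;
  rewrite -ltnS subn1 prednK ?(leq_ltn_trans (leq0n _) lty).
Qed.

Lemma lower_corner_exists M Y m : M m ->
  exists z, [/\ lower_corner M Y z, (z <= m)%MM & forall j, j \notin Y -> z j = m j].
Proof.
elim: {m}(mdeg m) {-2}m (leqnn (mdeg m)) => [|d IH] m; first last.
  have [/exists_inP [y yY /andP [y0 My]] mdm Mm|] :=
      boolP [exists y in Y, (0 < m y)%N && M (m - U_(y))%MM].
    have Um : (U_(y) <= m)%MM.
      by apply/mnm_lepP => j; rewrite mnm1E; case: eqP => // <-.
    have [|z [cz zm zY]] := IH (m - U_(y))%MM _ My.
      by move: mdm; rewrite -{1}(submK Um) mdegD mdeg1 addn1.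
    exists z; split=> // [|j jY]; first exact: lepm_trans zm (lem_subr _ _).
    rewrite zY // mnmBE mnm1E (_ : y == j = false) ?subn0 //.
    by apply: contraNF jY => /eqP <-.
  move=> /exists_inPn ncy _ Mm; exists m; split=> //; last exact: lepm_refl.
  by split=> // y yY y0; have := ncy y yY; rewrite y0.
rewrite leqn0 mdeg_eq0 => /eqP -> M0; exists 0%MM; split=> //; last exact: lepm_refl.
by split=> // y _; rewrite mnm0E.
Qed.

(** The bound [k <= n] covers the empty decomposition, whose depth is the
    default value [n]. *)
Lemma sdepth_ge r (Z : 'I_r -> {set 'I_n}) k :
  (k <= n)%N -> (forall i, (k <= #|Z i|)%N) -> (k <= sdepth_decomposition Z)%N.
Proof.
move=> kn kZ; apply: (big_ind (leq k)) => // u v; by rewrite leq_min => -> ->.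
Qed.

Lemma sdepth_le r (Z : 'I_r -> {set 'I_n}) : (sdepth_decomposition Z <= n)%N.
Proof.
by rewrite /sdepth_decomposition; elim/big_rec: _ => // i x _ xn; rewrite geq_min xn orbT.
Qed.

(** One piece for each corner [z] of a slice with [z <= N]; its free directions
    are those of [Y] and those [j] in which [z] reaches the cap [N j], so that
    all larger exponents at [j] belong to the same piece.  The piece of [m] has
    exponents [minn (m j) (N j)] outside [Y] and, in the directions of [Y], those
    of the corner of that slice; so it is unique. *)
Lemma stanley_decomposition_box I M (N : 'X_{1..n}) Y :
  (forall f, I f <-> mideal M f) -> upclosed M ->
  (forall m, M m -> M (mmin m N)) ->
  (forall m1 m2, M m1 -> M m2 -> (forall j, j \notin Y -> m1 j = m2 j) -> M (mmin m1 m2)) ->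
  exists r (z : 'I_r -> S) (Z : 'I_r -> {set 'I_n}), stanley_decomposition I z Z /\
    (#|Y :|: [set j | N j == 0%N]| <= sdepth_decomposition Z)%N.
Proof.
move=> IM Mu MN Mmin.
pose corner (z : 'X_{1..n}) :=
  M z && [forall y in Y, (0 < z y)%N ==> ~~ M (z - U_(y))%MM].
have cornerP z : reflect (lower_corner M Y z) (corner z).
  apply: (iffP andP) => -[Mz zY]; split=> //.
    by move=> y yY z0; have /forall_inP/(_ y yY)/implyP/(_ z0) := zY.
  by apply/forall_inP => y yY; apply/implyP; apply: zY.
pose P := [set z : 'X_{1..n < (mdeg N).+1} | corner z && (z <= N)%MM].
pose z (i : 'I_#|P|) : 'X_{1..n} := enum_val i.
pose Z (i : 'I_#|P|) := Y :|: [set j | z i j == N j].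
have zP i : lower_corner M Y (z i) /\ (z i <= N)%MM.
  by have := enum_valP i; rewrite inE => /andP [/cornerP].
have zoff i m : cell (z i) (Z i) m -> forall j, j \notin Y -> z i j = minn (m j) (N j).
  move=> /cellP [/mnm_lepP zm mz] j jY; have /mnm_lepP zN := (zP i).2.
  have [zN'|zN'] := eqVneq (z i j) (N j).
    by have := zm j; rewrite zN' => /minn_idPr.
  have /mz -> : j \notin Z i by rewrite !inE (negbTE jY).
  by apply/esym/minn_idPl.
exists #|P|, (fun i => 'X_[z i]), Z; split; last first.
  apply: sdepth_ge => [|i]; first by rewrite -[X in (_ <= X)%N]card_ord max_card.
  apply/subset_leq_card/setUS/subsetP => j; rewrite !inE => /eqP N0.
  by have /mnm_lepP/(_ j) := (zP i).2; rewrite N0 leqn0.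
apply: (stanley_decomposition_cells IM) => [i m /cellP [zm _]|m Mm|i j m ci cj].
- by have [[Mz _] _] := zP i; apply: upclosed_le zm Mz.
- (* The piece of [m] is the one of a corner below the truncation of [m]. *)
  have [z0 [cz0 z0m z0Y]] := lower_corner_exists Y (MN m Mm).
  have z0N : (z0 <= N)%MM.
    by apply: lepm_trans z0m _; apply/mnm_lepP => j; rewrite mnmE geq_minr.
  have bz0 : (mdeg z0 < (mdeg N).+1)%N.
    by rewrite ltnS -(submK z0N) mdegD leq_addl.
  have z0P : BMultinom bz0 \in P by rewrite inE z0N andbT; apply/cornerP.
  exists (enum_rank_in z0P (BMultinom bz0)); apply/cellP.
  rewrite /Z /z enum_rankK_in //=; split.
    by apply: lepm_trans z0m _; apply/mnm_lepP => j; rewrite mnmE geq_minl.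
  move=> j; rewrite !inE => /norP [jY]; rewrite z0Y // mnmE.
  by have [mN _|Nm] := leqP (m j) (N j); rewrite ?eqxx // (minn_idPl mN).
have zz k k' : cell (z k) (Z k) m -> cell (z k') (Z k') m -> (z k <= z k')%MM.
  move=> ck ck'; apply: (lower_corner_le Mu Mmin (zP k).1 (zP k').1.1) => l lY.
  by rewrite (zoff k m) // (zoff k' m).
apply/enum_val_inj/val_inj/mnmP => l /=; apply/eqP; rewrite eqn_leq.
by rewrite (mnm_lepP (zz i j ci cj) l) (mnm_lepP (zz j i cj ci) l).
Qed.

End StanleyDecompositions.

(** * Assembling the two bounds *)

Lemma is_max_nat_exists (P : nat -> Prop) b :
  (exists k, P k) -> (forall k, P k -> (k <= b)%N) -> exists m, is_max_nat P m.
Proof.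
move=> [k Pk]; elim: b => [|b IH] Pb.
  by exists k; split=> // j /Pb; rewrite leqn0 => /eqP ->.
have [Pb1|nPb] := classic (P b.+1); first by exists b.+1.
by apply: IH => j Pj; have := Pb j Pj; rewrite leq_eqVlt => /orP [/eqP jb|//];
  case: nPb; rewrite -jb.
Qed.

Section Conclusion.
Variables (K : fieldType) (n : nat).
Local Notation S := {mpoly K[n]}.
Implicit Types (M : pred 'X_{1..n}) (m s N : 'X_{1..n}) (T Y A B : {set 'I_n})
  (I Q : S -> Prop) (a b : 'I_n -> nat) (fs : seq S).

Definition stanley_inequality I := exists d s : nat,
  [/\ is_depth I d, is_sdepth I s & (d <= s)%N].

Lemma stanley_inequality_from_bounds I d0 : (exists2 g, I g & g != 0) ->
  (forall fs, regular_seq I fs -> (forall f, f \in fs -> graded_maximal_ideal f) ->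
     (size fs <= d0)%N) ->
  (exists r (z : 'I_r -> S) (Z : 'I_r -> {set 'I_n}),
     stanley_decomposition I z Z /\ (d0 <= sdepth_decomposition Z)%N) ->
  stanley_inequality I.
Proof.
move=> [g Ig g0] dI [r [z [Z [dec lez]]]].
have [||d dd] := @is_max_nat_exists (fun k => exists fs : seq S,
    [/\ size fs = k, (forall f, f \in fs -> graded_maximal_ideal f)
      & regular_seq I fs]) d0.
- exists 0%N, [::]; split=> //; split=> //; exists g => //.
  by move/seq_mul0/eqP; rewrite (negbTE g0).
- by move=> k [fs [<- fm reg]]; apply: dI.
have [||s ds] := @is_max_nat_exists (fun k =>
    exists r (z : 'I_r -> S) (Z : 'I_r -> {set 'I_n}),
    stanley_decomposition I z Z /\ sdepth_decomposition Z = k) n.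
- by exists (sdepth_decomposition Z), r, z, Z.
- by move=> k [? [? [? [_ <-]]]]; apply: sdepth_le.
exists d, s; split=> //.
have [[fs [<- fm reg]] _] := dd; apply: leq_trans (dI fs reg fm) (leq_trans lez _).
by have [_] := ds; apply; exists r, z, Z.
Qed.

(** The exponents of the monomials in [(x_i^(a i), i in A)]. *)
Definition power_exps A a : pred 'X_{1..n} := fun m => [exists i in A, (a i <= m i)%N].

Lemma power_exps_up A a : upclosed (power_exps A a).
Proof.
move=> m k /exists_inP [i iA am]; apply/exists_inP; exists i => //.
by rewrite mnmDE (leq_trans am) ?leq_addr.
Qed.

Lemma power_exps_mmin_bound A a (N : 'X_{1..n}) m : (forall i, i \in A -> (a i <= N i)%N) ->
  power_exps A a m -> power_exps A a (mmin m N).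
Proof.
move=> aN /exists_inP [i iA am]; apply/exists_inP; exists i => //.
by rewrite mnmE leq_min am aN.
Qed.

(** Along directions [Y] that contain at most one element of [A], the slices of
    this set are closed under minima. *)
Lemma power_exps_mmin A a Y m1 m2 :
  {in A :&: Y &, forall u v, u = v} ->
  power_exps A a m1 -> power_exps A a m2 -> (forall j, j \notin Y -> m1 j = m2 j) ->
  power_exps A a (mmin m1 m2).
Proof.
move=> AY /exists_inP [i iA am] /exists_inP [j jA bm] m12; apply/exists_inP.
have [iY|iY] := boolP (i \in Y); last first.
  by exists i => //; rewrite mnmE -m12 // minnn.
have [jY|jY] := boolP (j \in Y); last first.
  by exists j => //; rewrite mnmE m12 // minnn.
exists i => //; rewrite mnmE leq_min am.
by rewrite (AY i j) ?inE ?iA ?jA.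
Qed.

Lemma irreducible_mideal Q A a :
  (forall f, Q f <-> ideal_gen (fun g => exists2 i, i \in A & g = 'X_i ^+ a i) f) ->
  forall f, Q f <-> mideal (power_exps A a) f.
Proof.
move=> QE f; rewrite QE; split=> [[r [c [g [Gg ->]]]]|Mf].
  apply: mideal_sum => i _.
  apply: (is_idealM _ (@mideal_is_ideal K n _ (@power_exps_up A a))).
  have [j jA ->] := Gg i; rewrite mpolyXn; apply/midealX/exists_inP; exists j => //.
  by rewrite mulmnE mnm1E eqxx mul1n.
pose mk (k : 'I_(size (msupp f))) := nth 0%MM (msupp f) k.
have /fin_all_exists [i iP] (k : 'I_(size (msupp f))) :
    exists i, i \in A /\ (a i <= mk k i)%N.
  by have /Mf/exists_inP [i iA ai] := mem_nth 0%MM (ltn_ord k); exists i.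
exists (size (msupp f)), (fun k => f@_(mk k) *: 'X_[mk k - U_(i k) *+ a (i k)]),
  (fun k => 'X_(i k) ^+ a (i k)).
split=> [k|]; first by exists (i k); first exact: (iP k).1.
rewrite [LHS]mpolyE (big_nth 0%MM) big_mkord; apply: eq_bigr => k _.
rewrite mpolyXn -scalerAl -mpolyXD submK //; apply/mnm_lepP => j.
rewrite mulmnE mnm1E; case: eqP => [<-|_]; last by rewrite mul0n.
by rewrite mul1n; exact: (iP k).2.
Qed.

(** The dimension of the pieces of [stanley_decomposition_box], when the cap
    [N] is supported on [T]. *)
Lemma card_free_directions T Y (N : 'X_{1..n}) : Y \subset T ->
  (forall j, j \notin T -> N j = 0%N) ->
  (n - #|T| + #|Y| <= #|Y :|: [set j | N j == 0%N]|)%N.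
Proof.
move=> YT NT; have -> : (n - #|T| + #|Y|)%N = #|Y :|: ~: T|.
  rewrite cardsU; have -> : Y :&: ~: T = set0.
    by apply/setP => j; rewrite !inE; apply/negP => /andP [/(subsetP YT) ->].
  by rewrite cards0 subn0 addnC -[X in (X - _)%N](card_vars T) addnK.
by apply/subset_leq_card/setUS/subsetP => j; rewrite !inE => /NT ->.
Qed.

Definition exps A a : 'X_{1..n} := [multinom if j \in A then a j else 0%N | j < n].

Lemma exps_in A a i : i \in A -> exps A a i = a i.
Proof. by rewrite mnmE => ->. Qed.

Lemma exps_out A a i : i \notin A -> exps A a i = 0%N.
Proof. by rewrite mnmE => /negbTE ->. Qed.

(** The product of the [x_i^(a i - 1)], which spans the socle of the quotient
    of [K[x_i, i in A]] by the powers [x_i^(a i)]. *)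
Definition corner A a : 'X_{1..n} := exps A (fun j => (a j).-1).

Lemma corner_notin A a : (forall i, i \in A -> (0 < a i)%N) ->
  ~~ power_exps A a (corner A a).
Proof.
move=> a0; apply/exists_inPn => i iA.
by rewrite exps_in // -ltnNge ltn_predL a0.
Qed.

Lemma corner_socle A a i : (forall i, i \in A -> (0 < a i)%N) -> i \in A ->
  power_exps A a (corner A a + U_(i))%MM.
Proof.
move=> a0 iA; apply/exists_inP; exists i => //.
by rewrite mnmDE mnm1E eqxx addn1 exps_in // prednK // a0.
Qed.

Lemma subset1_unique (A : {set 'I_n}) (Y : {set 'I_n}) y :
  A :&: Y \subset [set y] -> {in A :&: Y &, forall u v, u = v}.
Proof. by move=> /subsetP AY u v /AY /set1P -> /AY /set1P ->. Qed.

(** Here [d0 = n - #|T| + 1]: the upper bound comes from the socle monomial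
    [x^s], the lower one from slicing along a single variable. *)
Lemma stanley_socle_case I M T s N : upclosed M ->
  (forall f, I f <-> mideal M f) -> T != set0 ->
  (forall m, M m -> M (mmin m N)) -> (forall i, i \notin T -> N i = 0%N) ->
  (forall i, i \notin T -> s i = 0%N) ->
  ~~ M s -> (forall i, i \in T -> M (s + U_(i))%MM) ->
  stanley_inequality I.
Proof.
move=> Mu IM T0 MN NT sT Ms MsU; have [y yT] := set0Pn _ T0.
apply: (@stanley_inequality_from_bounds I (n - #|T| + 1)).
- exists 'X_[s + U_(y)]; first exact/IM/midealX/MsU.
  by rewrite -msupp_eq0 msuppX.
- by move=> fs reg fm; apply: (depth_bound_socle Mu IM T0 sT Ms MsU reg fm).
have [|r [z [Z [dec le]]]] := @stanley_decomposition_box K n I M N [set y] IM Mu MN.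
  move=> m1 m2 M1 M2 m12; have [m1y|m2y] := leqP (m1 y) (m2 y).
    suff -> : mmin m1 m2 = m1 by [].
    apply/mnmP => j; rewrite mnmE; have [->|jy] := eqVneq j y.
      exact/minn_idPl.
    by rewrite m12 ?minnn // inE.
  suff -> : mmin m1 m2 = m2 by [].
  apply/mnmP => j; rewrite mnmE; have [->|jy] := eqVneq j y.
    exact/minn_idPr/ltnW.
  by rewrite m12 ?minnn // inE.
exists r, z, Z; split=> //; apply: leq_trans le.
by rewrite -(cards1 y); apply: card_free_directions => //; rewrite sub1set.
Qed.

Lemma stanley_irreducible I A a : (forall i, i \in A -> (0 < a i)%N) -> A != set0 ->
  (forall f, I f <-> mideal (power_exps A a) f) -> stanley_inequality I.
Proof.
move=> a0 A0 IM.
apply: (@stanley_socle_case I _ A (corner A a) (exps A a) (@power_exps_up A a) IM) => //.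
- by move=> m; apply: power_exps_mmin_bound => i iA; rewrite exps_in.
- by move=> i; apply: exps_out.
- by move=> i; apply: exps_out.
- exact: corner_notin.
- by move=> i; apply: corner_socle.
Qed.

(** The corner monomial [c] of [Q'] is multiplied into [Q'] by every variable
    of [B].  If it lies in [Q], then it is a socle monomial of [I] for [T = B].
    Otherwise [b i <= a i] on [A], so [Q] is contained in [Q'] and [I = Q]. *)
Lemma stanley_nested I A B a b :
  (forall i, i \in A -> (0 < a i)%N) -> (forall i, i \in B -> (0 < b i)%N) ->
  A != set0 -> B != set0 -> A \subset B ->
  (forall f, I f <-> mideal [pred m | power_exps A a m && power_exps B b m] f) ->
  stanley_inequality I.
Proof.
move=> a0 b0 A0 B0 AB IM.
have [As|As] := boolP (power_exps A a (corner B b)); last first.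
  apply: (stanley_irreducible a0 A0) => f; rewrite IM.
  suff eqM : [pred m | power_exps A a m && power_exps B b m] =1 power_exps A a.
    by split=> Mf m /Mf; rewrite eqM.
  move=> m /=; apply: andb_idr => /exists_inP [i iA am]; apply/exists_inP; exists i.
    exact: (subsetP AB).
  apply: leq_trans am; move/exists_inPn/(_ i iA): As.
  have iB := subsetP AB i iA; rewrite exps_in // -ltnNge prednK //; exact: b0.
pose N : 'X_{1..n} := [multinom maxn (exps A a j) (exps B b j) | j < n].
apply: (@stanley_socle_case I _ B (corner B b) N _ IM) => //.
- by move=> m k /andP [? ?]; apply/andP; split; apply: power_exps_up.
- move=> m /andP [? ?]; apply/andP; split; apply: power_exps_mmin_bound => // i iA.
    by rewrite mnmE exps_in // leq_maxl.
  by rewrite mnmE (exps_in b) // leq_maxr.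
- move=> i iB; rewrite mnmE !exps_out //.
  by apply: contraNN iB => /(subsetP AB).
- by move=> i; apply: exps_out.
- by rewrite /= negb_and corner_notin // orbT.
- move=> i iB; apply/andP; split; first exact: power_exps_up.
  exact: corner_socle.
Qed.

(** Here [d0 = n - #|A :|: B| + 2].  The exponents [c] are those of [Q + Q'], so
    that the corner of [c] is the socle monomial of its quotient; the slices are
    taken along the two variables [al] and [be], each of which occurs in the
    generators of only one of the two ideals. *)
Lemma stanley_crossing I A B a b al be :
  (forall i, i \in A -> (0 < a i)%N) -> (forall i, i \in B -> (0 < b i)%N) ->
  al \in A -> al \notin B -> be \in B -> be \notin A ->
  (forall f, I f <-> mideal [pred m | power_exps A a m && power_exps B b m] f) ->
  stanley_inequality I.
Proof.
move=> a0 b0 alA alB beB beA IM.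
pose T := A :|: B.
pose c j := if j \notin B then a j else if j \notin A then b j else minn (a j) (b j).
pose s := corner T c.
have c0 j : j \in T -> (0 < c j)%N.
  rewrite inE /c; case: (boolP (j \in B)) => jB; case: (boolP (j \in A)) => jA //= _.
  - by rewrite leq_min a0 ?b0.
  - exact: b0.
  - exact: a0.
have sA j : j \in A -> (s j < a j)%N.
  move=> jA; have jT : j \in T by rewrite inE jA.
  rewrite exps_in //; apply: leq_trans (_ : c j <= a j)%N.
    by rewrite prednK // c0.
  by rewrite /c jA; case: ifP => //= _; rewrite geq_minl.
have sB j : j \in B -> (s j < b j)%N.
  move=> jB; have jT : j \in T by rewrite inE jB orbT.
  rewrite exps_in //; apply: leq_trans (_ : c j <= b j)%N.
    by rewrite prednK // c0.
  by rewrite /c jB; case: ifP => //= _; rewrite geq_minr.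
have Mu : upclosed [pred m | power_exps A a m && power_exps B b m].
  by move=> m k /andP [? ?]; apply/andP; split; apply: power_exps_up.
have neab : al != be by apply: contraNneq alB => ->.
apply: (@stanley_inequality_from_bounds I (n - #|T| + 2)).
- exists 'X_[exps A a + exps B b]; last by rewrite -msupp_eq0 msuppX.
  apply/IM/midealX/andP; split; apply/exists_inP.
    by exists al => //; rewrite mnmDE exps_in // leq_addr.
  by exists be => //; rewrite mnmDE addnC (exps_in b) // leq_addr.
- move=> fs; apply: (@depth_bound_two K n I (power_exps A a) (power_exps B b) T s al be).
  + exact: power_exps_up.
  + exact: power_exps_up.
  + exact: IM.
  + by move=> i; apply: exps_out.
  + move=> i iT; have si : (c i <= (s + U_(i))%MM i)%N.
      by rewrite mnmDE mnm1E eqxx addn1 exps_in // prednK // c0.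
    move: si iT; rewrite /c inE; case: (boolP (i \in B)) => iB;
      case: (boolP (i \in A)) => iA //= si _.
    * move: si; rewrite geq_min => /orP [si|si]; apply/orP; [left|right].
        by apply/exists_inP; exists i.
      by apply/exists_inP; exists i.
    * by apply/orP; right; apply/exists_inP; exists i.
    * by apply/orP; left; apply/exists_inP; exists i.
  + by rewrite inE alA.
  + by rewrite inE beB orbT.
  + apply/exists_inPn => i iB; rewrite -ltnNge mnmDE mnm1E.
    rewrite (_ : al == i = false) ?addn0 ?sB //.
    by apply: contraNF alB => /eqP ->.
  + apply/exists_inPn => i iA; rewrite -ltnNge mnmDE mnm1E.
    rewrite (_ : be == i = false) ?addn0 ?sA //.
    by apply: contraNF beA => /eqP ->.
pose N : 'X_{1..n} := [multinom maxn (exps A a j) (exps B b j) | j < n].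
have [||r [z [Z [dec le]]]] := @stanley_decomposition_box K n I _ N [set al; be] IM Mu.
- move=> m /andP [? ?]; apply/andP; split; apply: power_exps_mmin_bound => // i iA.
    by rewrite mnmE exps_in // leq_maxl.
  by rewrite mnmE (exps_in b) // leq_maxr.
- move=> m1 m2 /andP [? ?] /andP [? ?] m12; apply/andP; split.
    apply: power_exps_mmin m12 => //; apply: (@subset1_unique _ _ al).
    apply/subsetP => j; rewrite !inE => /andP [jA /orP [//|/eqP jb]].
    by rewrite -jb jA in beA.
  apply: power_exps_mmin m12 => //; apply: (@subset1_unique _ _ be).
  apply/subsetP => j; rewrite !inE => /andP [jB /orP [/eqP ja|//]].
  by rewrite -ja jB in alB.
exists r, z, Z; split=> //; apply: leq_trans le.
have <- : #|[set al; be]| = 2%N by rewrite cards2 neab.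
apply: card_free_directions.
  by apply/subsetP => j; rewrite !inE => /orP [/eqP->|/eqP->]; rewrite ?alA ?beB ?orbT.
by move=> j; rewrite inE => /norP [jA jB]; rewrite mnmE !exps_out.
Qed.

Lemma power_exps_set_neq0 A a Q : (forall f, Q f <-> mideal (power_exps A a) f) ->
  ideal_nonzero Q -> A != set0.
Proof.
move=> QM [f /QM Mf]; rewrite -msupp_eq0; case E: (msupp f) => [//|m ms] _.
have /Mf/exists_inP [i iA _] : m \in msupp f by rewrite E mem_head.
by apply/set0Pn; exists i.
Qed.

End Conclusion.

Theorem theorem5p6 (K : fieldType) (n : nat) (Q Q' : {mpoly K[n]} -> Prop) :
  irreducible_monomial_ideal Q -> irreducible_monomial_ideal Q' ->
  ideal_nonzero Q -> ideal_nonzero Q' ->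
  exists d s : nat,
    [/\ is_depth (ideal_cap Q Q') d,
        is_sdepth (ideal_cap Q Q') s
      & (d <= s)%N].
Proof.
move=> [A [a [a0 QE]]] [B [b [b0 QE']]] Q0 Q0'.
have QM := irreducible_mideal QE; have QM' := irreducible_mideal QE'.
have A0 := power_exps_set_neq0 QM Q0; have B0 := power_exps_set_neq0 QM' Q0'.
have IM f : ideal_cap Q Q' f <->
    mideal [pred m | power_exps A a m && power_exps B b m] f.
  rewrite /ideal_cap QM QM'; split=> [[Mf Mf'] m mf|Mf].
    by rewrite /= Mf ?Mf'.
  by split=> m /Mf /andP [].
have [AB|/subsetPn [al alA alB]] := boolP (A \subset B).
  exact: (stanley_nested a0 b0 A0 B0 AB IM).
have [BA|/subsetPn [be beB beA]] := boolP (B \subset A).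
  apply: (stanley_nested b0 a0 B0 A0 BA) => f; rewrite IM.
  by split=> Mf m /Mf; rewrite /= andbC.
exact: (stanley_crossing a0 b0 alA alB beB beA IM).
Qed.
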